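(* There exists a prediction system $\mathcal{U}=(U_1,U_2,\ldots)$ that is universal in the following sense: for any prediction system $\mathcal{L}=(L_1,L_2,\ldots)$ there exists a constant $c>0$ such that, for all $N\in\mathbb{N}$, $$\mathcal{L}_{\le N}\subseteq\mathcal{U}_{\le cN}.$$
   Context: $\mathbf{X}$ is a fixed finite set of binary strings (the object space), $\mathbb{2}:=\{0,1\}$ (the label space), $\mathbb{N}=\{1,2,\ldots\}$. Elements of $(\mathbf{X}\times\mathbb{2})^*$ are called finite data sequences; $\sigma_1\sqsubseteq\sigma_2$ means that $\sigma_1$ is a prefix of $\sigma_2$, and $\sigma_1\sqsubset\sigma_2$ means $\sigma_1\sqsubseteq\sigma_2$ and $\sigma_1\ne\sigma_2$. A law of nature is a recursively enumerable prefix-free subset $L\subseteq(\mathbf{X}\times\mathbb{2})^*$ (prefix-free: there are no $\sigma_1,\sigma_2\in L$ with $\sigma_1\sqsubset\sigma_2$; $L=\emptyset$ is allowed). A prediction system (also called weak prediction system) is a sequence $\mathcal{L}=(L_1,L_2,\ldots)$ of laws of nature that are jointly recursively enumerable, i.e., the set $\{(\sigma,n)\in(\mathbf{X}\times\mathbb{2})^*\times\mathbb{N}\mid\sigma\in L_n\}$ is recursively enumerable. For a real number $r\ge0$, $\mathcal{L}_{\le r}:=\bigcup_{n\in\mathbb{N},\,n\le r}L_n$. *)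

(* Defs.v *)
From HB Require Import structures.
From mathcomp Require Import all_boot all_order all_algebra finmap.
From mathcomp Require Import boolp classical_sets reals.

Set Implicit Arguments.
Unset Strict Implicit.
Unset Printing Implicit Defensive.

Local Open Scope classical_set_scope.

(** Kleene's partial recursive functions.  [Prec f g] recurses on its first
    argument; [g] receives the counter, the previous value and the remaining
    arguments.  The variable searched by [Mu f] is the first argument of [f]. *)
Inductive recfun : nat -> Type :=
| Zero (n : nat) : recfun n
| Succ : recfun 1
| Proj (n : nat) (i : 'I_n) : recfun n
| Comp (k n : nat) (f : recfun k) (g : 'I_k -> recfun n) : recfun n
| Prec (n : nat) (f : recfun n) (g : recfun n.+2) : recfun n.+1
| Mu (n : nat) (f : recfun n.+1) : recfun n.

(** [eval c v y]: the partial function with code [c] is defined at [v], with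
    value [y].  In the [Prec] clause [t] is the table of intermediate values.
    In the [Mu] clause [f] must be defined at every smaller candidate. *)
Fixpoint eval (n : nat) (c : recfun n) : n.-tuple nat -> nat -> Prop :=
  match c in recfun n return n.-tuple nat -> nat -> Prop with
  | Zero _ => fun _ y => y = 0
  | Succ => fun v y => y = (thead v).+1
  | Proj _ i => fun v y => y = tnth v i
  | Comp k _ f g => fun v y =>
      exists2 w : k.-tuple nat,
        (forall i, eval (g i) v (tnth w i)) & eval f w y
  | Prec _ f g => fun v y =>
      let x := behead_tuple v in
      exists t : nat -> nat,
        [/\ eval f x (t 0),
            forall i, i < thead v -> eval g [tuple of i :: t i :: x] (t i.+1)
          & y = t (thead v)]
  | Mu _ f => fun v y =>
      eval f [tuple of y :: v] 0 /\
      forall z, z < y -> exists u, eval f [tuple of z :: v] u.+1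
  end.

(** A subset of [T] is recursively enumerable, relative to a coding of [T] by
    tuples of natural numbers, when it is the domain of a partial recursive
    function of the codes.  For the two codings used below the set of all codes
    is decidable, so it does not matter how the function behaves on tuples that
    are not codes. *)
Definition recursively_enumerable (T : Type) (k : nat)
    (code : T -> k.-tuple nat) (A : set T) : Prop :=
  exists c : recfun k, forall x, A x <-> exists y, eval c (code x) y.

Definition posnat : Type := {n : nat | 0 < n}.

Section PredictionSystems.
Variable X : {fset bitseq}.

Definition dataseq : Type := seq (X * bool).

Definition sprefix (s1 s2 : dataseq) : bool := prefix s1 s2 && (s1 != s2).

(** Letters are numbered by their rank in an enumeration of the finite alphabet
    (any numbering gives the same r.e. sets); [CodeSeq.code] is the library's
    computable bijection from [seq nat] to [nat]. *)
Definition code_dataseq (s : dataseq) : nat :=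
  CodeSeq.code [seq nat_of_ord (enum_rank a) | a <- s].

Definition code1 (s : dataseq) : 1.-tuple nat := [tuple code_dataseq s].

Definition code2 (p : dataseq * posnat) : 2.-tuple nat :=
  [tuple code_dataseq p.1; val p.2].

Definition prefix_free (L : set dataseq) : Prop :=
  ~ exists s1 s2, [/\ L s1, L s2 & sprefix s1 s2].

Definition law_of_nature (L : set dataseq) : Prop :=
  recursively_enumerable code1 L /\ prefix_free L.

Definition prediction_system (L : posnat -> set dataseq) : Prop :=
  (forall n, law_of_nature (L n)) /\
  recursively_enumerable code2 [set p | L p.2 p.1].

Definition laws_le (R : realType) (L : posnat -> set dataseq) (r : R) :
    set dataseq :=
  \bigcup_(n in [set n : posnat | ((val n)%:R <= r)%R]) L n.

End PredictionSystems.

(* Main.v *)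
Require Import Defs.
From Stdlib Require Import PeanoNat.
From mathcomp Require Import all_boot all_order all_algebra finmap zify.
From mathcomp Require Import boolp classical_sets reals.

(* Every program is a number [e], and a terminating run of it is witnessed by a
   finite set of judgments, coded by the binary digits of a number [S], in which
   every judgment is locally justified by other ones; being such a certificate
   is decidable by bounded quantification. The law number [2^e (2n+1)] of the
   universal system accepts, stage by stage, the strings on which [e] accepts
   [(string, n)], skipping those that are comparable with a string found
   earlier. The result is always prefix-free, and nothing is skipped if program
   [e] enumerates a prediction system, which gives a constant of order [2^e]. *)

Set Implicit Arguments.
Unset Strict Implicit.
Unset Printing Implicit Defensive.

(** * Computable functions and decidable relations *)

(** Functions act on lists rather than tuples, so that arguments are added and dropped by cons and
    [behead] without casts between arities; only the values on lists of length [n] are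
    constrained. *)
Definition computable n (f : seq nat -> nat) : Prop :=
  exists c : recfun n, forall (v : n.-tuple nat) y, eval c v y <-> y = f v.

Lemma computable_ext n f g : f =1 g -> computable n f -> computable n g.
Proof. by move=> fg [c cP]; exists c => v y; rewrite -fg. Qed.

Lemma computable_var n i : i < n -> computable n (fun v => nth 0 v i).
Proof.
move=> lt_in; exists (Proj (Ordinal lt_in)) => v y /=.
by rewrite (tnth_nth 0).
Qed.

Lemma computable_subst k n f (h : seq nat -> seq nat) :
    (forall v : n.-tuple nat, size (h v) = k) ->
    (forall i, i < k -> computable n (fun v => nth 0 (h v) i)) ->
  computable k f -> computable n (fun v => f (h v)).
Proof.
move=> sz_h h_comp [cf cfP].
have /choice[cg cgP] (i : 'I_k) := h_comp i (ltn_ord i).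
exists (Comp cf cg) => v y /=; split=> [[w wP /cfP->]|->].
  congr (f _); apply: (@eq_from_nth _ 0) => [|i]; first by rewrite size_tuple.
  rewrite size_tuple => lt_ik.
  by have /cgP := wP (Ordinal lt_ik); rewrite (tnth_nth 0).
have sz : size (h v) == k by rewrite sz_h.
exists (Tuple sz); last exact/cfP.
by move=> i; apply/cgP; rewrite (tnth_nth 0).
Qed.

Lemma computable_head n : computable n.+1 (fun v => head 0 v).
Proof.
by apply: computable_ext (computable_var (ltn0Sn n)) => v; rewrite nth0.
Qed.

Lemma computable_weak n f :
  computable n f -> computable n.+1 (fun v => f (behead v)).
Proof.
apply: computable_subst => [v|i lt_in]; first by rewrite size_behead size_tuple.
by apply: computable_ext (computable_var (lt_in : i.+1 < n.+1)) => v;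
  rewrite nth_behead.
Qed.

Lemma computable_succ n f : computable n f -> computable n (fun v => (f v).+1).
Proof.
move=> f_comp.
suff: computable n (fun v => (head 0 [:: f v]).+1) by [].
apply: (@computable_subst 1 n (fun w => (head 0 w).+1)
          (fun v => [:: f v])) => //.
  by case.
by exists Succ => v y; case/tupleP: v => a v; rewrite /= theadE.
Qed.

Lemma computable_const n c : computable n (fun=> c).
Proof.
elim: c => [|c IHc]; last exact: computable_succ.
by exists (Zero n).
Qed.

Lemma computable_rec n b f g :
    computable n b -> computable n f -> computable n.+2 g ->
  computable n (fun v => nat_rect (fun=> nat) (f v)
                           (fun i z => g [:: i, z & v]) (b v)).
Proof.
move=> b_comp [cf cfP] [cg cgP].
(* [Prec] recurses on its first argument, so the counter is first made a separate leading argument;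
   [b v] is then substituted for it. *)
pose F w := nat_rect (fun=> nat) (f (behead w))
              (fun i z => g [:: i, z & behead w]) (head 0 w).
apply: (@computable_subst n.+1 n F (fun v => b v :: v)) => [v|[|i]|] //=.
- by rewrite size_tuple.
- by move=> lt_in; apply: computable_var.
exists (Prec cf cg) => w y; case/tupleP: w => m v /=; rewrite theadE.
split=> [[t [/cfP t0 tS ->]]|->]; rewrite /F /=.
  have tS' i : i < m -> t i.+1 = g [:: i, t i & v] by move=> /tS /cgP.
  elim: m tS' {tS} t0 => [|m IHm] tS t0 //=.
  by rewrite -IHm ?tS // => i lt_im; apply: tS; apply: ltnW.
exists (nat_rect (fun=> nat) (f v) (fun i z => g [:: i, z & v])).
by split=> // [|i _]; [apply/cfP | apply/cgP].
Qed.

Lemma computable_weak2 n f :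
  computable n f -> computable n.+2 (fun v => f (behead (behead v))).
Proof. by move/computable_weak/computable_weak. Qed.

Lemma computable_add n f g :
  computable n f -> computable n g -> computable n (fun v => f v + g v).
Proof.
move=> f_comp g_comp.
apply: computable_ext (computable_rec f_comp g_comp
  (computable_succ (computable_weak (@computable_head n)))).
by move=> v; elim: (f v) => //= m ->.
Qed.

Lemma computable_mul n f g :
  computable n f -> computable n g -> computable n (fun v => f v * g v).
Proof.
move=> f_comp g_comp.
apply: computable_ext (computable_rec f_comp (@computable_const n 0)
  (computable_add (computable_weak2 g_comp)
                  (computable_weak (@computable_head n)))).
by move=> v; elim: (f v) => //= m ->.
Qed.

Lemma computable_pred n f : computable n f -> computable n (fun v => (f v).-1).
Proof.
move=> f_comp.
apply: computable_ext (computable_rec f_comp (@computable_const n 0)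
  (@computable_head n.+1)).
by move=> v; case: (f v).
Qed.

Lemma computable_sub n f g :
  computable n f -> computable n g -> computable n (fun v => f v - g v).
Proof.
move=> f_comp g_comp.
apply: computable_ext (computable_rec g_comp f_comp
  (computable_pred (computable_weak (@computable_head n)))).
by move=> v; elim: (g v) => [|m /= ->]; rewrite ?subn0 ?subnS.
Qed.

Lemma computable_exp2 n f : computable n f -> computable n (fun v => 2 ^ f v).
Proof.
move=> f_comp.
apply: computable_ext (computable_rec f_comp (@computable_const n 1)
  (computable_mul (@computable_const n.+2 2)
                  (computable_weak (@computable_head n)))).
by move=> v; elim: (f v) => //= m ->; rewrite expnS.
Qed.

(** Truth is the value 0, so that conjunction becomes a sum, disjunction a product, and [Mu] can
    search for a witness directly. *)
Definition decidable_rel n (P : seq nat -> Prop) : Prop :=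
  exists2 f, computable n f & forall v : n.-tuple nat, P v <-> f v = 0.

Lemma decidable_ext n (P Q : seq nat -> Prop) :
    (forall v : n.-tuple nat, P v <-> Q v) ->
  decidable_rel n P -> decidable_rel n Q.
Proof. by move=> PQ [f f_comp fP]; exists f => // v; rewrite -PQ. Qed.

Lemma decidable_le n f g :
  computable n f -> computable n g -> decidable_rel n (fun v => f v <= g v).
Proof.
move=> f_comp g_comp; exists (fun v => f v - g v); first exact: computable_sub.
by move=> v; split=> /eqP.
Qed.

Lemma decidable_and n P Q : decidable_rel n P -> decidable_rel n Q ->
  decidable_rel n (fun v => P v /\ Q v).
Proof.
move=> [f f_comp fP] [g g_comp gP].
exists (fun v => f v + g v); first exact: computable_add.
by move=> v; rewrite fP gP; lia.
Qed.

Lemma decidable_or n P Q : decidable_rel n P -> decidable_rel n Q ->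
  decidable_rel n (fun v => P v \/ Q v).
Proof.
move=> [f f_comp fP] [g g_comp gP].
exists (fun v => f v * g v); first exact: computable_mul.
by move=> v; rewrite fP gP; nia.
Qed.

Lemma decidable_not n P : decidable_rel n P -> decidable_rel n (fun v => ~ P v).
Proof.
move=> [f f_comp fP]; exists (fun v => 1 - f v).
  exact: computable_sub (@computable_const n 1) f_comp.
by move=> v; rewrite fP; lia.
Qed.

Lemma decidable_imp n P Q : decidable_rel n P -> decidable_rel n Q ->
  decidable_rel n (fun v => P v -> Q v).
Proof.
move=> Pdec Qdec; apply: decidable_ext (decidable_or (decidable_not Pdec) Qdec).
by move=> v; rewrite implyE.
Qed.

Lemma decidable_eq n f g :
  computable n f -> computable n g -> decidable_rel n (fun v => f v = g v).
Proof.
move=> f_comp g_comp.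
apply: decidable_ext (decidable_and (decidable_le f_comp g_comp)
                                    (decidable_le g_comp f_comp)).
by move=> v; lia.
Qed.

Lemma decidable_all n b (P : nat -> seq nat -> Prop) :
    computable n b -> decidable_rel n.+1 (fun w => P (head 0 w) (behead w)) ->
  decidable_rel n (fun v => forall x, x < b v -> P x v).
Proof.
move=> b_comp [f f_comp fP].
(* A sum of natural numbers vanishes exactly when all its terms do. *)
exists (fun v => nat_rect (fun=> nat) 0 (fun i z => z + f (i :: v)) (b v)).
  apply: (computable_rec (g := fun w => head 0 (behead w) +
            f (head 0 w :: behead (behead w)))) => //.
    exact: computable_const.
  apply: computable_add; first exact/computable_weak/computable_head.
  apply: computable_subst f_comp => [w|[|i] lt_in] /=.
  - by rewrite !size_behead size_tuple.
  - exact: computable_head.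
  apply: computable_ext (computable_var (lt_in : i.+2 < n.+2)) => w.
  by rewrite !nth_behead.
move=> v; elim: (b v) => [|m IHm] //=; split=> [Pv|/eqP].
  apply/eqP; rewrite addn_eq0; apply/andP; split; apply/eqP.
    by apply/IHm => x lt_xm; apply: Pv; apply: ltnW.
  by have /fP := Pv m (ltnSn m) : P (head 0 [tuple of m :: v]) _.
rewrite addn_eq0 => /andP[/eqP/IHm Pv /eqP fm x].
rewrite ltnS leq_eqVlt => /orP[/eqP->|/Pv//].
exact: (iffRL (fP [tuple of m :: v])).
Qed.

(* The bound is a side condition, so that the relations themselves can be
   stated with unbounded quantifiers. *)
Lemma decidable_ex n b (P : nat -> seq nat -> Prop) :
    computable n b -> (forall v x, P x v -> x <= b v) ->
    decidable_rel n.+1 (fun w => P (head 0 w) (behead w)) ->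
  decidable_rel n (fun v => exists x, P x v).
Proof.
move=> b_comp Pb /decidable_not Pdec.
apply: decidable_ext (decidable_not
  (decidable_all (P := fun x v => ~ P x v) (computable_succ b_comp) Pdec)).
move=> v; split=> [nP|[x Px] /(_ x)]; last by apply; rewrite // ltnS Pb.
by apply: contrapT => nE; apply: nP => x _ Px; apply: nE; exists x.
Qed.

(** The set is the domain of the unbounded search [Mu] applied to the decision function. *)
Lemma re_ex (T : Type) k (code : T -> k.-tuple nat)
    (P : nat -> seq nat -> Prop) :
    decidable_rel k.+1 (fun w => P (head 0 w) (behead w)) ->
  recursively_enumerable code [set x | exists s, P s (code x)].
Proof.
move=> [f [c cP] fP]; exists (Mu c) => x /=.
have Pf s : P s (code x) <-> f (s :: code x) = 0.
  exact: fP [tuple of s :: code x].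
split=> [[s0 /Pf/eqP fs0]|[s [/cP fs _]]]; last by exists s; apply/Pf.
have ex0 : exists s, f (s :: code x) == 0 by exists s0.
(* At the least zero the search succeeds: all earlier values are positive, hence successors, as the
   [Mu] clause of [eval] demands. *)
case: (ex_minnP ex0) => s /eqP fs min_s; exists s; split; first exact/cP.
move=> z lt_zs; exists (f (z :: code x)).-1; apply/cP => /=.
by rewrite prednK // lt0n; apply: contraL lt_zs => /min_s; rewrite -leqNgt.
Qed.

(** * Certificates of computations *)

(** A polynomial pairing that dominates both components, so that components can be found by bounded
    search. With [s = a + b], the value lies between [s * s] and [s * s + s], hence determines [s]
    and then [a]. *)
Definition npair a b := (a + b) * (a + b) + a.

Lemma npair_inj a b a' b' : npair a b = npair a' b' -> a = a' /\ b = b'.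
Proof.
rewrite /npair => E.
have lt x y z t : x + y < z + t -> npair x y < npair z t.
  by rewrite /npair; nia.
have Es : a + b = a' + b'.
  by case: (ltngtP (a + b) (a' + b')) => // /lt; rewrite /npair E ltnn.
by rewrite Es in E; lia.
Qed.

Lemma npair_gel a b : a <= npair a b.
Proof. by rewrite /npair; nia. Qed.

Lemma npair_ger a b : b <= npair a b.
Proof. by rewrite /npair; nia. Qed.

(** The digit of weight [2 ^ j] in [S] is 1, expressed by arithmetic and quantifiers that can be
    bounded by [S]. A number thus represents the finite set of the positions of its ones. *)
Definition bit j S : Prop :=
  exists q r, r < 2 ^ j /\ S = (2 * q + 1) * 2 ^ j + r.

Lemma expn2E j : 2 ^ j = Nat.pow 2 j.
Proof. by elim: j => // j IHj; rewrite expnS IHj Nat.pow_succ_r'. Qed.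

Lemma bitE j S : bit j S <-> Nat.testbit S j = true.
Proof.
split=> [[q [r [lt_r ->]]]|Sj].
  by apply: (Nat.testbit_unique _ _ true r q); rewrite -expn2E /=; lia.
have [r [q [[_ lt_r] ->]]] := Nat.testbit_spec S j.
by rewrite Sj -expn2E in lt_r *; exists q, r; rewrite /=; split; lia.
Qed.

Lemma bit_lt j S : bit j S -> j < S.
Proof.
by move=> [q [r [_ ->]]]; have := ltn_expl j (isT : 1 < 2); nia.
Qed.

Lemma bit_union S T : exists V, forall j, bit j V <-> bit j S \/ bit j T.
Proof.
exists (Nat.lor S T) => j; rewrite !bitE Nat.lor_spec.
by case: (Nat.testbit S j); case: (Nat.testbit T j); intuition.
Qed.

Lemma bit_insert j S : exists V, forall i, bit i V <-> i = j \/ bit i S.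
Proof.
exists (Nat.setbit S j) => i; rewrite !bitE Nat.setbit_iff.
by split=> -[->|]; auto.
Qed.

(** * Programs, judgments and certificates *)

Definition judgment c v y := npair c (npair v y).

Lemma judgment_inj c v y c' v' y' :
  judgment c v y = judgment c' v' y' -> [/\ c = c', v = v' & y = y'].
Proof. by move=> /npair_inj[-> /npair_inj[-> ->]]. Qed.

(** Programs take a single number, lists of arguments being nested pairs; pairing and the two
    projections replace arities. The first component of a code is a tag. *)
Definition cZero := npair 0 0.
Definition cSucc := npair 0 1.
Definition cFst := npair 0 2.
Definition cSnd := npair 0 3.
Definition cPair f g := npair 1 (npair f g).
Definition cComp f g := npair 2 (npair f g).
Definition cPrec f g := npair 3 (npair f g).
Definition cMu f := npair 4 f.

(* One step of the evaluation of the program [c] on [v], with value [y], the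
   values of the subcomputations being given by the relation [M]. *)
Definition justified (M : nat -> nat -> nat -> Prop) c v y : Prop :=
  (c = cZero /\ y = 0) \/
  (c = cSucc /\ exists a b, v = npair a b /\ y = a.+1) \/
  (c = cFst /\ exists a b, v = npair a b /\ y = a) \/
  (c = cSnd /\ exists a b, v = npair a b /\ y = b) \/
  (exists f g, c = cPair f g /\
     exists a b, y = npair a b /\ (M f v a /\ M g v b)) \/
  (exists f g, c = cComp f g /\ exists w, M g v w /\ M f w y) \/
  (exists f g, c = cPrec f g /\ exists n x, v = npair n x /\
     ((n = 0 /\ M f x y) \/
      exists m, n = m.+1 /\ exists z,
        M c (npair m x) z /\ M g (npair m (npair z x)) y)) \/
  (exists f, c = cMu f /\
     (M f (npair y v) 0 /\ forall z, z < y -> exists u, M f (npair z v) u.+1)).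

Definition in_certificate S c v y := bit (judgment c v y) S.

(* Circular justifications are harmless: a judgment on a program only depends on
   judgments on its subprograms or, for recursion, on a smaller argument. *)
Definition certificate S : Prop :=
  forall c v y, in_certificate S c v y -> justified (in_certificate S) c v y.

Definition derivable c v y : Prop :=
  exists S, certificate S /\ in_certificate S c v y.

(** [M] occurs only positively in [justified], including under the bounded quantifier of the [cMu]
    clause. Justifications therefore survive when a certificate is enlarged. *)
Lemma justified_mono (M M' : nat -> nat -> nat -> Prop) c v y :
    (forall c v y, M c v y -> M' c v y) ->
  justified M c v y -> justified M' c v y.
Proof.
rewrite /justified => MM'.
case=> [|[|[|[|[|[|[|]]]]]]]; do ?[by auto 10].
- move=> [f [g [-> [a [b [-> [/MM' ? /MM' ?]]]]]]].
  by do 4!right; left; exists f, g; split=> //; exists a, b.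
- move=> [f [g [-> [w [/MM' ? /MM' ?]]]]].
  by do 5!right; left; exists f, g; split=> //; exists w.
- move=> [f [g [-> [n [x [-> D]]]]]].
  do 6!right; left; exists f, g; split=> //; exists n, x; split=> //.
  case: D => [[-> /MM' ?]|[m [-> [z [/MM' ? /MM' ?]]]]]; first by left.
  by right; exists m; split=> //; exists z.
- move=> [f [-> [/MM' ? H]]]; do 7!right; exists f; split=> //; split=> //.
  by move=> z /H[u /MM' ?]; exists u.
Qed.

Lemma in_certificate_union S T : certificate S -> certificate T ->
  exists2 V, certificate V & forall c v y,
    in_certificate V c v y <-> in_certificate S c v y \/ in_certificate T c v y.
Proof.
move=> S_ok T_ok; have [V VE] := bit_union S T.
exists V; last by move=> c v y; apply: VE.
move=> c v y /VE[/S_ok|/T_ok]; apply: justified_mono => ? ? ? ?; apply/VE.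
  by left.
by right.
Qed.

Lemma justified_derivable S c v y :
  certificate S -> justified (in_certificate S) c v y -> derivable c v y.
Proof.
move=> S_ok just_c; have [V VE] := bit_insert (judgment c v y) S.
exists V; split; last by apply/VE; left.
have SV c' v' y' : in_certificate S c' v' y' -> in_certificate V c' v' y'.
  by move=> ?; apply/VE; right.
move=> c' v' y' /VE[/judgment_inj[-> -> ->]|/S_ok].
  exact: justified_mono SV just_c.
exact: justified_mono.
Qed.

Lemma certificate0 : certificate 0.
Proof. by move=> c v y /bit_lt. Qed.

(** The [cMu] clause has a variable number of premises; their certificates are merged one at a
    time. *)
Lemma certificate_family (f : nat) (arg : nat -> nat) m :
    (forall z, z < m -> exists u, derivable f (arg z) u.+1) ->
  exists2 S, certificate S &
    forall z, z < m -> exists u, in_certificate S f (arg z) u.+1.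
Proof.
elim: m => [|m IHm] Hd; first by exists 0 => //; exact: certificate0.
have [z /ltnW /Hd//|S S_ok SE] := IHm.
have [u [T [T_ok Tm]]] := Hd m (ltnSn m).
have [V V_ok VE] := in_certificate_union S_ok T_ok.
exists V => // z; rewrite ltnS leq_eqVlt => /orP[/eqP->|/SE[w Sw]].
  by exists u; apply/VE; right.
by exists w; apply/VE; left.
Qed.

(** Every clause has finitely many premises, whose certificates can be merged into one and then
    extended by the conclusion. *)
Lemma derivable_fix c v y : derivable c v y <-> justified derivable c v y.
Proof.
split=> [[S [S_ok /S_ok]]|].
  by apply: justified_mono => ? ? ? ?; exists S.
(* The four clauses without premises are justified by the empty certificate, coded by 0. *)
have base : justified (in_certificate 0) c v y -> derivable c v y.
  exact/justified_derivable/certificate0.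
case=> [|[|[|[|[|[|[|]]]]]]] => H;
  do ?[by apply: base; rewrite /justified; auto 10].
- have [f [g [-> [a [b [-> [[S [S_ok Sa]] [T [T_ok Tb]]]]]]]]] := H.
  have [V V_ok VE] := in_certificate_union S_ok T_ok.
  apply: (justified_derivable V_ok); do 4!right; left; exists f, g; split=> //.
  by exists a, b; split=> //; split; apply/VE; auto.
- have [f [g [-> [w [[S [S_ok Sa]] [T [T_ok Tb]]]]]]] := H.
  have [V V_ok VE] := in_certificate_union S_ok T_ok.
  apply: (justified_derivable V_ok); do 5!right; left; exists f, g; split=> //.
  by exists w; split; apply/VE; auto.
- have [f [g [-> [n [x [-> [[-> [S [S_ok Sa]]]|]]]]]]] := H.
    apply: (justified_derivable S_ok); do 6!right; left.
    by exists f, g; split=> //; exists 0, x; split=> //; left.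
  move=> [m [-> [z [[S [S_ok Sa]] [T [T_ok Tb]]]]]].
  have [V V_ok VE] := in_certificate_union S_ok T_ok.
  apply: (justified_derivable V_ok); do 6!right; left.
  exists f, g; split=> //; exists m.+1, x; split=> //; right.
  by exists m; split=> //; exists z; split; apply/VE; auto.
- have [f [-> [[S [S_ok Sa]] /certificate_family[T T_ok Tb]]]] := H.
  have [V V_ok VE] := in_certificate_union S_ok T_ok.
  apply: (justified_derivable V_ok); do 7!right; exists f; split=> //.
  split=> [|z /Tb[u Tu]]; first by apply/VE; left.
  by exists u; apply/VE; right.
Qed.

(** Distinct tags refute all clauses of [justified] but one; injectivity of [npair] then identifies
    the components. *)
Ltac invert_codes :=
  repeat match goal with
  | H : _ \/ _ |- _ => destruct H as [H|H]
  | H : _ /\ _ |- _ => destruct H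
  | H : exists _, _ |- _ => destruct H
  | H : npair _ _ = npair _ _ |- _ => apply npair_inj in H
  | H : 0 = _.+1 |- _ => discriminate H
  | H : _.+1 = 0 |- _ => discriminate H
  | H : _.+1 = _.+1 |- _ => injection H as H
  | H : _ = ?x |- _ => subst x
  | H : ?x = _ |- _ => subst x
  end.

Ltac derivation_inversion :=
  rewrite derivable_fix /justified /cZero /cSucc /cFst /cSnd /cPair /cComp
    /cPrec /cMu => H; invert_codes.

Lemma derivable_Zero v y : derivable cZero v y <-> y = 0.
Proof.
split; first by derivation_inversion.
by move=> ->; apply/derivable_fix; left.
Qed.

Lemma derivable_Succ a x y : derivable cSucc (npair a x) y <-> y = a.+1.
Proof.
split; first by derivation_inversion.
by move=> ->; apply/derivable_fix; right; left; split=> //; exists a, x.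
Qed.

Lemma derivable_Fst a x y : derivable cFst (npair a x) y <-> y = a.
Proof.
split; first by derivation_inversion.
by move=> ->; apply/derivable_fix; do 2!right; left; split=> //; exists a, x.
Qed.

Lemma derivable_Snd a x y : derivable cSnd (npair a x) y <-> y = x.
Proof.
split; first by derivation_inversion.
by move=> ->; apply/derivable_fix; do 3!right; left; split=> //; exists a, x.
Qed.

Lemma derivable_Pair f g v y : derivable (cPair f g) v y <->
  exists a b, [/\ y = npair a b, derivable f v a & derivable g v b].
Proof.
split=> [|[a [b [-> fa gb]]]]; first by derivation_inversion;
  do 2!eexists; split; eauto.
apply/derivable_fix; do 4!right; left; exists f, g; split=> //.
by exists a, b.
Qed.

Lemma derivable_Comp f g v y : derivable (cComp f g) v y <->
  exists2 w, derivable g v w & derivable f w y.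
Proof.
split=> [|[w gw fy]]; first by derivation_inversion; eexists; eauto.
apply/derivable_fix; do 5!right; left; exists f, g; split=> //.
by exists w.
Qed.

Lemma derivable_Prec f g m x y : derivable (cPrec f g) (npair m x) y <->
  exists t : nat -> nat,
    [/\ derivable f x (t 0),
        forall i, i < m -> derivable g (npair i (npair (t i) x)) (t i.+1)
      & y = t m].
Proof.
split=> [|[t [t0 tS ->]]].
  elim: m y => [|m IHm] y.
    by derivation_inversion; exists (fun=> y).
  derivation_inversion.
  match goal with H : derivable (npair 3 _) _ _, H' : derivable _ _ y |- _ =>
    move: H H' => /IHm[t [t0 tS Et]] gy end.
  (* The table of the shorter run, extended by the value [y] at [m.+1]. *)
  exists (fun i => if i <= m then t i else y); split=> [||]; rewrite ?ltnn //.
  by move=> i; rewrite ltnS; case: ltngtP => // [/tS|->]; rewrite -?Et.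
elim: m tS => [|m IHm] tS; apply/derivable_fix; do 6!right; left.
  by exists f, g; split=> //; exists 0, x; split=> //; left.
exists f, g; split=> //; exists m.+1, x; split=> //; right.
exists m; split=> //; exists (t m); split; last exact: tS.
by apply: IHm => i lt_im; apply: tS; apply: ltnW.
Qed.

Lemma derivable_Mu f v y : derivable (cMu f) v y <->
  derivable f (npair y v) 0 /\
  forall z, z < y -> exists u, derivable f (npair z v) u.+1.
Proof.
split; first by derivation_inversion.
by move=> [fy fz]; apply/derivable_fix; do 7!right; exists f.
Qed.

(** * Translation of partial recursive functions into programs *)

Fixpoint encode (v : seq nat) : nat :=
  if v is a :: v' then npair a (encode v') else 0.

Fixpoint cProj i := if i is j.+1 then cComp (cProj j) cSnd else cFst.

Fixpoint cTuple (s : seq nat) :=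
  if s is c :: s' then cPair c (cTuple s') else cZero.

Fixpoint program n (c : recfun n) : nat :=
  match c with
  | Zero _ => cZero
  | Succ => cSucc
  | Proj _ i => cProj i
  | Comp k _ f g => cComp (program f)
      (cTuple [seq program (g i) | i <- enum 'I_k])
  | Prec _ f g => cPrec (program f) (program g)
  | Mu _ f => cMu (program f)
  end.

Lemma derivable_Proj i v y : i < size v ->
  derivable (cProj i) (encode v) y <-> y = nth 0 v i.
Proof.
elim: i v y => [|i IHi] [//|a v] y /=; first by rewrite derivable_Fst.
rewrite ltnS => /IHi IH; rewrite derivable_Comp.
by split=> [[w /derivable_Snd->] /IH|/IH]; last by exists (encode v);
  rewrite ?derivable_Snd.
Qed.

Lemma derivable_Tuple (s : seq nat) v y : derivable (cTuple s) v y <->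
  exists w, [/\ size w = size s, y = encode w &
    forall i, i < size s -> derivable (nth 0 s i) v (nth 0 w i)].
Proof.
elim: s y => [|c s IHs] y /=.
  rewrite derivable_Zero; split=> [->|[w [/size0nil-> ->]]] //.
  by exists [::].
rewrite derivable_Pair; split=> [[a [b [-> ca /IHs[w [sz_w -> sw]]]]]|].
  by exists (a :: w); rewrite /= sz_w; split=> // -[|i] //= /sw.
move=> [[|a w] [//= [sz_w] -> sw]]; exists a, (encode w); split=> //.
  exact: (sw 0).
by apply/IHs; exists w; split=> // i; apply: (sw i.+1).
Qed.

(** Certificates thus provide a universal interpreter: [derivable] is one relation that covers the
    codes of all arities. The induction matches each clause of [eval] with the characterization of
    the corresponding instruction. *)
Lemma eval_derivable n (c : recfun n) (v : n.-tuple nat) y :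
  eval c v y <-> derivable (program c) (encode v) y.
Proof.
elim: c v y => {n} [n||n i|k n f IHf g IHg|n f IHf g IHg|n f IHf] v y /=.
- by rewrite derivable_Zero.
- by case/tupleP: v => a v /=; rewrite theadE derivable_Succ.
- by rewrite derivable_Proj ?size_tuple // (tnth_nth 0).
- rewrite derivable_Comp.
  have nthE (i : 'I_k) :
      nth 0 [seq program (g j) | j <- enum 'I_k] i = program (g i).
    by rewrite (nth_map i) ?size_enum_ord // nth_ord_enum.
  split=> [[w gw fy]|[z /derivable_Tuple[w [sz_w -> gw]] fy]].
    exists (encode w); last exact/IHf.
    apply/derivable_Tuple; exists w; rewrite size_map size_enum_ord size_tuple.
    split=> // i lt_ik; rewrite (nthE (Ordinal lt_ik)).
    by apply/IHg; have := gw (Ordinal lt_ik); rewrite (tnth_nth 0).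
  rewrite size_map size_enum_ord in sz_w gw.
  have /eqP sz := sz_w.
  exists (Tuple sz); last exact/IHf.
  by move=> i; apply/IHg; rewrite (tnth_nth 0) -nthE; apply: gw.
- case/tupleP: v => m v /=; rewrite theadE derivable_Prec.
  split=> [[t [t0 tS ->]]|[t [t0 tS ->]]]; exists t; split=> //.
  + exact/(IHf (behead_tuple [tuple of m :: v])).
  + by move=> i /tS/IHg.
  + exact/(IHf (behead_tuple [tuple of m :: v])).
  + by move=> i /tS ?; apply/IHg.
- rewrite derivable_Mu; split=> [[/IHf fy fz]|[fy fz]]; split=> //.
  + by move=> z /fz[u /IHf fu]; exists u.
  + exact/IHf.
  + by move=> z /fz[u fu]; exists u; apply/IHf.
Qed.

(** * Decidability of certificates *)

Lemma computable_weakn k n f : computable n f ->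
  computable (k + n) (fun v => f (iter k behead v)).
Proof.
move=> f_comp; elim: k => [//|k IHk].
apply: computable_ext (computable_weak IHk) => v /=; congr f.
by elim: (k) {IHk} => //= m ->.
Qed.

(** Variables bound by enclosing quantifiers stand in front of the argument list; they are dropped
    until a known computable function is reached. *)
Ltac computable_variable :=
  first
    [ eassumption
    | exact: computable_head
    | apply (@computable_weakn 1); computable_variable
    | apply (@computable_weakn 2); computable_variable
    | apply (@computable_weakn 3); computable_variable
    | apply (@computable_weakn 4); computable_variable
    | apply (@computable_weakn 5); computable_variable
    | apply (@computable_weakn 6); computable_variable ].

Lemma computable_npair n f g : computable n f -> computable n g ->
  computable n (fun v => npair (f v) (g v)).
Proof.
move=> f_comp g_comp; have s_comp := computable_add f_comp g_comp.
exact: computable_add (computable_mul s_comp s_comp) f_comp.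
Qed.

Ltac computability :=
  lazymatch goal with
  | |- computable _ (fun _ => ?c) => exact: computable_const
  | |- computable _ (fun v => (@?f v).+1) =>
      apply: computable_succ; computability
  | |- computable _ (fun v => @?f v + @?g v) =>
      apply: computable_add; computability
  | |- computable _ (fun v => @?f v * @?g v) =>
      apply: computable_mul; computability
  | |- computable _ (fun v => 2 ^ @?f v) =>
      apply: computable_exp2; computability
  | |- computable _ (fun v => npair (@?f v) (@?g v)) =>
      apply: computable_npair; computability
  | _ => computable_variable
  end.

Lemma decidable_bit n j S : computable n j -> computable n S ->
  decidable_rel n (fun v => bit (j v) (S v)).
Proof.
move=> j_comp S_comp; apply: (decidable_ex S_comp) => [v q [r [_ ->]]|].
  by have := expn_gt0 2 (j v); nia.
apply: (decidable_ex (b := fun w => S (behead w))) => [|v r [_ ->]|].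
- computability.
- exact: leq_addl.
apply: decidable_and; first by apply: decidable_le; computability.
by apply: decidable_eq; computability.
Qed.

(** This bounds every quantifier over programs, arguments or values that occur in a certificate. *)
Lemma in_certificate_lt S c v y :
  in_certificate S c v y -> [/\ c < S, v < S & y < S].
Proof.
move=> /bit_lt; have := npair_gel c (npair v y).
have := npair_ger c (npair v y); have := npair_gel v y; have := npair_ger v y.
by rewrite /judgment => *; split; lia.
Qed.

Lemma decidable_in_certificate n S c v y :
    computable n S -> computable n c -> computable n v -> computable n y ->
  decidable_rel n (fun w => in_certificate (S w) (c w) (v w) (y w)).
Proof.
by move=> *; apply: decidable_bit; rewrite // /judgment; computability.
Qed.

Ltac decidability :=
  lazymatch goal with
  | |- decidable_rel _ (fun v => is_true (_ <= _)) =>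
      apply: decidable_le; computability
  | |- decidable_rel _ (fun v => _ = _) =>
      apply: decidable_eq; computability
  | |- decidable_rel _ (fun v => _ /\ _) =>
      apply: decidable_and; decidability
  | |- decidable_rel _ (fun v => _ \/ _) =>
      apply: decidable_or; decidability
  | |- decidable_rel _ (fun v => ~ _) =>
      apply: decidable_not; decidability
  | |- decidable_rel _ (fun v => forall x, is_true (x < _) -> _) =>
      apply: decidable_all; [computability | decidability]
  | |- decidable_rel _ (fun v => _ -> _) =>
      apply: decidable_imp; decidability
  | |- decidable_rel _ (fun w =>
         in_certificate (@?S w) (@?c w) (@?v w) (@?y w)) =>
      apply (@decidable_in_certificate _ S c v y); computability
  | _ => idtac
  end.

Ltac npair_bound :=
  let w := fresh in let x := fresh in
  let H := fresh in move=> w x H;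
  repeat match goal with
  | H : _ \/ _ |- _ => destruct H as [H|H]
  | H : _ /\ _ |- _ => destruct H
  | H : exists _, _ |- _ => destruct H
  | H : in_certificate _ _ _ _ |- _ => apply in_certificate_lt in H; destruct H
  | H : _ = npair _ _ |- _ => revert H
  end;
  repeat match goal with
  | |- context [npair ?a ?b] =>
      move: (npair_gel a b) (npair_ger a b); generalize (npair a b)
  end; lia.

Ltac bounded_by b :=
  apply: (decidable_ex (b := b));
  [computability | npair_bound | decidability].

(** Every existential variable is a component of [c], [v] or [y], or occurs in a judgment of the
    certificate and is bounded by [S]. Each [behead] in a bound skips one variable already
    introduced. *)
Lemma decidable_justified n S c v y :
    computable n S -> computable n c -> computable n v -> computable n y ->
  decidable_rel n (fun w => justified (in_certificate (S w)) (c w) (v w) (y w)).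
Proof.
move=> S_comp c_comp v_comp y_comp.
rewrite /justified /cZero /cSucc /cFst /cSnd /cPair /cComp /cPrec /cMu.
decidability.
all: try (bounded_by v; bounded_by (fun w => v (behead w))).
- bounded_by c; bounded_by (fun w => c (behead w)).
  bounded_by (fun w => y (behead (behead w))).
  bounded_by (fun w => y (behead (behead (behead w)))).
- bounded_by c; bounded_by (fun w => c (behead w)).
  bounded_by (fun w => S (behead (behead w))).
- bounded_by c; bounded_by (fun w => c (behead w)).
  bounded_by (fun w => v (behead (behead w))).
  bounded_by (fun w => v (behead (behead (behead w)))).
  (* The list starts with [x] and [n] here, so the predecessor [m] is bounded by [n]. *)
  bounded_by (fun w => head 0 (behead w)).
  bounded_by (fun w => S (behead (behead (behead (behead (behead w)))))).
- bounded_by c.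
  bounded_by (fun w => S (behead (behead w))).
Qed.

Lemma decidable_certificate n S :
  computable n S -> decidable_rel n (fun w => certificate (S w)).
Proof.
move=> S_comp.
apply: (@decidable_ext n (fun w => forall c, c < S w -> forall v, v < S w ->
  forall y, y < S w -> in_certificate (S w) c v y ->
  justified (in_certificate (S w)) c v y)).
  move=> w; split=> [H c v y Sc|H c _ v _ y _]; last exact: H.
  by have [? ? ?] := in_certificate_lt Sc; apply: H.
decidability.
by apply: decidable_justified; computability.
Qed.

(** * Codes of sequences *)

Lemma code_cons n s :
  CodeSeq.code (n :: s) = 2 ^ n * (2 * CodeSeq.code s + 1).
Proof. by rewrite /= -mul2n addn1. Qed.

Lemma code_eq0 s : CodeSeq.code s = 0 -> s = [::].
Proof.
by case: s => // n s; rewrite code_cons; have := expn_gt0 2 n; nia.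
Qed.

Lemma dvdn_remainder_eq0 d q r m : r < d -> q * d + r = m -> d %| m -> r = 0.
Proof.
move=> lt_r <-; rewrite dvdn_addr ?dvdn_mull // => /eqP.
by rewrite modn_small.
Qed.

Lemma ltn_low_digits P Q d : 0 < P -> d < Q -> P * (2 * d + 1) < 2 * P * Q.
Proof. by move=> P_gt0 lt_dQ; nia. Qed.

(** For [P = 2 ^ n] and [Q] a power of 2, this strips the first entry [n] of a sequence: the
    remainder is the code of a sequence that also starts with [n], and the tails are in the same
    relation modulo [Q]. *)
Lemma low_digits P Q C x r :
    0 < P -> r < 2 * P * Q -> P * (2 * C + 1) = x * (2 * P * Q) + r ->
  exists d, [/\ d < Q, C = x * Q + d & r = P * (2 * d + 1)].
Proof.
move=> P_gt0 lt_r E.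
have le_xC : x * Q <= C.
  rewrite leqNgt; apply/negP => lt_Cx.
  have : P * (2 * C + 1) < P * (2 * (x * Q)) by rewrite ltn_pmul2l //; lia.
  by lia.
rewrite -(subnKC le_xC) in E *; set d := C - _ in E *.
have Er : r = P * (2 * d + 1) by lia.
exists d; split=> //; rewrite ltnNge; apply/negP => le_Qd.
have : P * (2 * Q) < P * (2 * d + 1) by rewrite ltn_pmul2l //; lia.
by lia.
Qed.

(* [CodeSeq.code [:: n_1; ..; n_k]] has binary digits
   [1 0^n_k .. 1 0^n_1], so that prefixes of a sequence are the remainders of
   its code modulo powers of 2. *)
Definition code_sprefix a b : Prop :=
  exists k q, a < 2 ^ k /\ b = q.+1 * 2 ^ k + a.

Lemma code_sprefixP s1 s2 :
  code_sprefix (CodeSeq.code s1) (CodeSeq.code s2) <->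
  exists2 r, r != [::] & s2 = s1 ++ r.
Proof.
split=> [|[r r_neq0 ->]]; last first.
  elim: s1 => [|n s1 [k [q [lt_k E]]]].
    (* For empty [s1] the quotient is the whole code, which is positive because [r] is nonempty. *)
    case: r r_neq0 => // n r _; exists 0, (CodeSeq.code (n :: r)).-1.
    by rewrite code_cons /=; have := expn_gt0 2 n; nia.
  exists (n.+1 + k), q; rewrite cat_cons !code_cons E expnD expnS.
  by split; [exact: ltn_low_digits (expn_gt0 2 n) lt_k | lia].
elim: s2 s1 => [|n s2 IHs] s1 [k [q [lt_k]]].
  by rewrite /=; have := expn_gt0 2 k; nia.
(* If [k <= n], the modulus divides the whole code, so the remainder is 0 and [s1] is empty.
   Otherwise both sequences start with [n], and the induction hypothesis applies to the tails. *)
rewrite code_cons; have [le_kn|lt_nk] := leqP k n.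
  rewrite -(subnKC le_kn) expnD => E.
  have /code_eq0-> : CodeSeq.code s1 = 0; last by exists (k + (n - k) :: s2).
  apply: (dvdn_remainder_eq0 lt_k (esym E)).
  by rewrite -mulnA dvdn_mulr.
move: lt_k; rewrite -(subnKC lt_nk) expnD expnS => lt_k E.
have [d [lt_d Es2 Es1]] := low_digits (expn_gt0 2 n) lt_k E.
have {}Es1 : CodeSeq.code s1 = CodeSeq.code (n :: CodeSeq.decode d).
  by rewrite code_cons CodeSeq.decodeK.
rewrite (can_inj CodeSeq.codeK Es1).
have [|r r_neq0 ->] := IHs (CodeSeq.decode d); last by exists r.
by exists (k - n.+1), q; rewrite CodeSeq.decodeK.
Qed.

(** The binary expansion has [K] consecutive zeros with a one somewhere above them. Such a run lies
    within the zeros of a single entry, which is therefore at least [K]. *)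
Definition code_large K b : Prop :=
  exists k r p, r < 2 ^ k /\ b = p.+1 * 2 ^ (K + k) + r.

Lemma code_largeP K s :
  code_large K (CodeSeq.code s) <-> exists2 n, n \in s & K <= n.
Proof.
split.
  elim: s => [|n s IHs] [k [r [p [lt_r]]]].
    by rewrite /=; have := expn_gt0 2 (K + k); nia.
  (* A run that starts at [k <= n] belongs to the zeros of the first entry; otherwise it lies above
     the lowest one and is found in the tail. *)
  rewrite code_cons; have [le_kn|lt_nk] := leqP k n => E.
    exists n; first exact: mem_head.
    rewrite leqNgt; apply/negP => lt_nK.
    have r0 : r = 0.
      apply: (@dvdn_remainder_eq0 (2 ^ k) (p.+1 * 2 ^ K) _ _ lt_r).
        by rewrite -mulnA -expnD -E.
      by apply: dvdn_mulr; apply: dvdn_exp2l.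
    move: E; rewrite r0 -(subnKC lt_nK) !expnD expnS.
    move=> E; have : 2 ^ n * (2 * CodeSeq.code s + 1) ==
        2 ^ n * (2 * (p.+1 * (2 ^ (K - n.+1) * 2 ^ k))) by lia.
    by rewrite eqn_pmul2l ?expn_gt0 // => /eqP; lia.
  move: lt_r E; rewrite -(subnKC lt_nk) addnCA !expnD expnS => lt_r E.
  have {}E : 2 ^ n * (2 * CodeSeq.code s + 1) =
             p.+1 * 2 ^ K * (2 * 2 ^ n * 2 ^ (k - n.+1)) + r.
    by rewrite E; lia.
  have [d [lt_d Es Er]] := low_digits (expn_gt0 2 n) lt_r E.
  have [m mS le_Km] : exists2 m, m \in s & K <= m; last first.
    by exists m; rewrite // inE mS orbT.
  by apply: IHs; exists (k - n.+1), d, p; rewrite expnD mulnA.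
move=> [n + le_Kn]; elim: s => // m s IHs; rewrite inE => /orP[/eqP<-|/IHs].
  (* The [K] highest of the [n] trailing zeros form the run. *)
  exists (n - K), 0, (2 * CodeSeq.code s).
  by rewrite expn_gt0 subnKC // code_cons; split=> //; lia.
move=> [k [r [p [lt_r E]]]].
exists (m.+1 + k), (2 ^ m * (2 * r + 1)), p; rewrite code_cons E.
rewrite addnCA [2 ^ (m.+1 + (_ + _))]expnD [2 ^ (m.+1 + k)]expnD !expnS.
by split; [exact: ltn_low_digits (expn_gt0 2 m) lt_r | lia].
Qed.

(** * The universal prediction system *)

Lemma decidable_code_sprefix n a b : computable n a -> computable n b ->
  decidable_rel n (fun w => code_sprefix (a w) (b w)).
Proof.
move=> a_comp b_comp.
apply: (decidable_ex (b := b)) => [//|w k [q [lt_k ->]]|].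
  by have := ltn_expl k (isT : 1 < 2); nia.
apply: (decidable_ex (b := fun w => b (behead w))) => [|w q [lt_k ->]|].
- computability.
- by have := expn_gt0 2 (head 0 w); nia.
- decidability.
Qed.

Lemma decidable_code_large n K b : computable n b ->
  decidable_rel n (fun w => code_large K (b w)).
Proof.
move=> b_comp.
apply: (decidable_ex (b := b)) => [//|w k [r [p [lt_k ->]]]|].
  have := expn_gt0 2 K; rewrite expnD.
  by have := ltn_expl k (isT : 1 < 2); nia.
apply: (decidable_ex (b := fun w => b (behead w))) => [|w r [p [_ ->]]|].
- computability.
- exact: leq_addl.
apply: (decidable_ex (b := fun w => b (behead (behead w)))) => [|w p [_ ->]|].
- computability.
- by have := expn_gt0 2 (K + head 0 (behead w)); nia.
- decidability.
Qed.

(* At stage [S], the string coded by [a] is proposed for the [m]-th law: [m]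
   determines [e] and [n], and [e] is run on [a] and [n]. *)
Definition proposed m a S : Prop :=
  certificate S /\ exists e n, m = 2 ^ e * (2 * n + 1) /\
    exists y, in_certificate S e (encode [:: a; n]) y.

(** This is why [accepted_at] may restrict the competing strings to [b < T]. *)
Lemma proposed_lt m a S : proposed m a S -> a < S.
Proof.
move=> [_ [e [n [_ [y /in_certificate_lt[_ lt_S _]]]]]].
exact: leq_ltn_trans (npair_gel _ _) lt_S.
Qed.

Lemma decidable_proposed n m a S :
    computable n m -> computable n a -> computable n S ->
  decidable_rel n (fun w => proposed (m w) (a w) (S w)).
Proof.
move=> m_comp a_comp S_comp; rewrite /proposed /=; apply: decidable_and.
  exact: decidable_certificate.
apply: (decidable_ex (b := m)) => [//|w e [k [-> _]]|].
  by have := ltn_expl e (isT : 1 < 2); nia.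
apply: (decidable_ex (b := fun w => m (behead w))) => [|w k [-> _]|].
- computability.
- by have := expn_gt0 2 (head 0 w); nia.
decidability.
bounded_by (fun w => S (behead (behead w))).
Qed.

Definition code_comparable a b := code_sprefix a b \/ code_sprefix b a.

(* A proposed string is accepted unless a comparable one has been proposed
   before, in the lexicographic order of pairs (stage, string). *)
Definition accepted_at K m a S : Prop :=
  proposed m a S /\ forall T, T < S.+1 -> forall b, b < T ->
    ~ code_large K b -> proposed m b T -> code_comparable a b ->
    T = S /\ a < b.

Lemma decidable_accepted_at n K m a S :
    computable n m -> computable n a -> computable n S ->
  decidable_rel n (fun w => accepted_at K (m w) (a w) (S w)).
Proof.
move=> m_comp a_comp S_comp; rewrite /accepted_at /code_comparable.
decidability.
- exact: decidable_proposed.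
- by apply: decidable_code_large; computability.
- apply (@decidable_proposed _ (fun w => m (behead (behead w))) (head 0)
           (fun w => head 0 (behead w))); computability.
- apply (@decidable_code_sprefix _ (fun w => a (behead (behead w))) (head 0));
    computability.
- apply (@decidable_code_sprefix _ (head 0) (fun w => a (behead (behead w))));
    computability.
Qed.

(** * The universal system over a fixed alphabet: prefix-freeness, enumerability and universality *)

Section Universal.
Variable X : {fset bitseq}.

Let K := #|{: X * bool}|.

Lemma code_dataseq_sprefix (s1 s2 : dataseq X) :
  code_sprefix (code_dataseq s1) (code_dataseq s2) <-> sprefix s1 s2.
Proof.
rewrite code_sprefixP /sprefix; split=> [[r r_neq0]|/andP[/prefixP[r ->]]].
  have inj : injective (fun a : X * bool => nat_of_ord (enum_rank a)).
    by move=> a b /val_inj/enum_rank_inj.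
  move=> E.
  have Er : r = [seq nat_of_ord (enum_rank a) | a <- drop (size s1) s2].
    by rewrite map_drop E drop_size_cat ?size_map.
  have -> : s2 = s1 ++ drop (size s1) s2.
    by apply: (inj_map inj); rewrite E map_cat -Er.
  rewrite prefix_prefix /= -[X in X != _]cats0 eqseq_cat // eqxx /=.
  by apply: contraNneq r_neq0 => E0; rewrite Er -E0.
rewrite -[X in X != _]cats0 eqseq_cat // eqxx /= => r_neq0.
exists [seq nat_of_ord (enum_rank a) | a <- r]; last exact: map_cat.
by case: r r_neq0.
Qed.

(** Letters are numbered from 0 to [K - 1], so a number codes a data sequence exactly when no entry
    of its decoding reaches [K]. *)
Lemma code_dataseqP b :
  ~ code_large K b <-> exists s : dataseq X, b = code_dataseq s.
Proof.
rewrite -[b]CodeSeq.decodeK code_largeP; split=> [small|[s E]].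
  have lt_K n : n \in CodeSeq.decode b -> n < K.
    by move=> n_b; rewrite ltnNge; apply/negP => le_Kn; apply: small; exists n.
  elim: (CodeSeq.decode b) lt_K => [|n t IHt] lt_K; first by exists [::].
  have [|s Es] := IHt.
    by move=> m m_t; apply: lt_K; rewrite inE m_t orbT.
  exists (enum_val (Ordinal (lt_K n (mem_head n t))) :: s).
  rewrite /code_dataseq /= enum_valK /=.
  by rewrite -[CodeSeq.code (map _ _)]Es.
rewrite (can_inj CodeSeq.codeK E) => -[n /mapP[a _ ->]].
by rewrite leqNgt ltn_ord.
Qed.

Definition universal_system (m : posnat) : set (dataseq X) :=
  [set s | exists S, accepted_at K (val m) (code_dataseq s) S].

(** Of two comparable accepted strings, the one that comes later in the order of pairs (stage,
    string) would have been blocked by the other. *)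
Lemma universal_system_prefix_free m : prefix_free (universal_system m).
Proof.
move=> [s1 [s2 [[S1 [p1 first1]] [S2 [p2 first2]] lt_s]]].
have small (s : dataseq X) : ~ code_large K (code_dataseq s).
  by apply/code_dataseqP; exists s.
have C12 := iffRL (code_dataseq_sprefix s1 s2) lt_s.
have le21 : S2 <= S1 -> S2 = S1 /\ code_dataseq s1 < code_dataseq s2.
  by move=> le; apply: first1 => //; [exact: proposed_lt p2 | left].
have le12 : S1 <= S2 -> S1 = S2 /\ code_dataseq s2 < code_dataseq s1.
  by move=> le; apply: first2 => //; [exact: proposed_lt p1 | right].
by case: (ltngtP S1 S2) => [/ltnW/le12|/ltnW/le21|E]; [lia|lia|];
  case: le12; rewrite ?E //; case: le21; rewrite ?E //; lia.
Qed.

Lemma universal_system_prediction : prediction_system universal_system.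
Proof.
split=> [m|].
  split; last exact: universal_system_prefix_free.
  apply: (@re_ex _ _ _ (fun S w => accepted_at K (val m) (head 0 w) S)).
  apply (@decidable_accepted_at _ _ (fun=> val m)
           (fun w => head 0 (behead w)) (head 0)); computability.
(* For joint enumerability the law number is no longer a constant but the second entry of the
   code. *)
apply: (@re_ex _ _ _ (fun S w =>
  accepted_at K (head 0 (behead w)) (head 0 w) S)).
apply (@decidable_accepted_at _ _ (fun w => head 0 (behead (behead w)))
         (fun w => head 0 (behead w)) (head 0)); computability.
Qed.

(** A law number determines its program and argument, by comparing parities and halving. *)
Lemma exp2_odd_inj e n e' n' :
  2 ^ e * (2 * n + 1) = 2 ^ e' * (2 * n' + 1) -> e = e' /\ n = n'.
Proof.
elim: e e' => [|e IHe] [|e']; rewrite ?expn0 ?expnS -?mulnA.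
- by lia.
- by move: (2 ^ e' * _) => x; lia.
- by move: (2 ^ e * _) => x; lia.
by move=> E; have [|-> ->] := IHe e'; lia.
Qed.

Lemma proposed_program (c : recfun 2) a n :
  (exists y, eval c [tuple a; n] y) <->
  exists S, proposed (2 ^ program c * (2 * n + 1)) a S.
Proof.
split=> [[y /eval_derivable[S [S_ok Sy]]]|[S [S_ok [e [k [E [y Sy]]]]]]].
  by exists S; split=> //; exists (program c), n; split=> //; exists y.
exists y; apply/eval_derivable; exists S; split=> //.
by have [-> ->] := exp2_odd_inj E.
Qed.

Lemma universal_system_contains (L : posnat -> set (dataseq X)) :
    prediction_system L ->
  exists k, forall (n : posnat) s, L n s ->
    exists2 m : posnat, val m <= k * val n & universal_system m s.
Proof.
(* The factor 3 comes from [2 * n + 1 <= 3 * n] for positive [n]. *)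
move=> [L_laws [c cP]]; exists (2 ^ program c * 3) => n s Lns.
have m_gt0 : 0 < 2 ^ program c * (2 * val n + 1).
  by rewrite muln_gt0 expn_gt0 addn1.
exists (Sub (2 ^ program c * (2 * val n + 1)) m_gt0 : posnat).
  by rewrite /= -mulnA leq_mul //; case: n {Lns m_gt0} => n /=; lia.
have /proposed_program[S pS] := iffLR (cP (s, n)) Lns.
(* Any stage that proposes [s] accepts it: a comparable competitor, proposed at whatever stage,
   would also belong to [L n], against prefix-freeness. *)
exists S; split=> // T _ b _ /code_dataseqP[s' ->] pT Css'.
have Ls' : L n s'.
  by apply: (iffRL (cP (s', n))); apply/proposed_program; exists T.
have [_ []] := L_laws n.
by case: Css' => /code_dataseq_sprefix; [exists s, s' | exists s', s].
Qed.

End Universal.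

Import Order.TTheory GRing.Theory Num.Theory.
Local Open Scope classical_set_scope.
Local Open Scope ring_scope.

Theorem theorem1 (R : realType) (X : {fset bitseq}) :
  exists U : posnat -> set (dataseq X),
    prediction_system U /\
    forall L : posnat -> set (dataseq X), prediction_system L ->
      exists c : R, 0 < c /\
        forall N : posnat,
          laws_le L ((val N)%:R : R) `<=` laws_le U (c * (val N)%:R).
Proof.
exists (@universal_system X); split; first exact: universal_system_prediction.
(* The successor makes the constant positive, whatever [k] is. *)
move=> L /universal_system_contains[k kP]; exists k.+1%:R; split=> // N s.
move=> [n /=]; rewrite ler_nat => le_nN /kP[m le_m Ums]; exists m => //=.
by rewrite -natrM ler_nat; apply: leq_trans le_m _; apply: leq_mul.
Qed.
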